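(* Let $p$ be a prime and $q$ a power of $p$. The group $\mathrm{SL}(2,\overline{\mathbb{F}_q})$ is not acceptable.
   Context: $\overline{\mathbb{F}_q}$ denotes an algebraic closure of the finite field $\mathbb{F}_q$, and $\mathrm{SL}(2,\overline{\mathbb{F}_q})$ is the group of $2\times 2$ matrices of determinant $1$ over it. Let $\Gamma$ be a group and $H$ a finite group. Two homomorphisms $\phi_1,\phi_2:H\to\Gamma$ are element-conjugate if for every $x\in H$ there is $h(x)\in\Gamma$ with $\phi_1(x)=h(x)^{-1}\phi_2(x)h(x)$; they are globally conjugate if one can choose a single $h\in\Gamma$ with $\phi_1(x)=h^{-1}\phi_2(x)h$ for all $x\in H$. The group $\Gamma$ is acceptable if for every finite group $H$, any two element-conjugate homomorphisms $H\to\Gamma$ are globally conjugate. *)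

(* Defs.v *)
From HB Require Import structures.
From mathcomp Require Import all_boot all_order all_fingroup all_algebra all_field.

Set Implicit Arguments.
Unset Strict Implicit.
Unset Printing Implicit Defensive.

Import GRing.Theory.

Section SpecialLinear.
Local Open Scope ring_scope.
Variables (n : nat) (R : comUnitRingType).

Inductive SLtype : predArgType := SLmx (A : 'M[R]_n) of \det A == 1.

Definition SLval (u : SLtype) : 'M[R]_n := let: SLmx A _ := u in A.

HB.instance Definition _ := [isSub for SLval].
HB.instance Definition _ := [Choice of SLtype by <:].

Lemma SLval_det u : \det (SLval u) = 1.
Proof. exact/eqP/(valP u). Qed.

Lemma SLval_unit u : SLval u \in unitmx.
Proof. by rewrite unitmxE SLval_det unitr1. Qed.

Fact SL_one_subproof : \det (1%:M : 'M[R]_n) == 1.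
Proof. by rewrite det1. Qed.

Fact SL_mul_subproof u v : \det (SLval u *m SLval v) == 1.
Proof. by rewrite det_mulmx !SLval_det mulr1. Qed.

Fact SL_inv_subproof u : \det (invmx (SLval u)) == 1.
Proof. by rewrite det_inv SLval_det invr1. Qed.

Definition SL_one := SLmx SL_one_subproof.
Definition SL_mul u v := SLmx (SL_mul_subproof u v).
Definition SL_inv u := SLmx (SL_inv_subproof u).

Fact SL_mulA : associative SL_mul.
Proof. by move=> u v w; apply: val_inj; rewrite /= mulmxA. Qed.

Fact SL_mul1 : left_id SL_one SL_mul.
Proof. by move=> u; apply: val_inj; rewrite /= mul1mx. Qed.

Fact SL_mulr1 : right_id SL_one SL_mul.
Proof. by move=> u; apply: val_inj; rewrite /= mulmx1. Qed.

Fact SL_mulV : left_inverse SL_one SL_inv SL_mul.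
Proof. by move=> u; apply: val_inj; rewrite /= mulVmx ?SLval_unit. Qed.

Fact SL_mulrV : right_inverse SL_one SL_inv SL_mul.
Proof. by move=> u; apply: val_inj; rewrite /= mulmxV ?SLval_unit. Qed.

HB.instance Definition _ :=
  isGroup.Build SLtype SL_mulA SL_mul1 SL_mulr1 SL_mulV SL_mulrV.

End SpecialLinear.

Notation "''SL_' n [ R ]" := (SLtype n R)
  (at level 8, n at level 2, format "''SL_' n [ R ]") : type_scope.

Section Acceptable.
Local Open Scope group_scope.

(* Conjugation is the library's x ^ h := h^-1 * (x * h). *)
Definition element_conjugate (G : groupType) (H : finGroupType)
    (phi1 phi2 : {multiplicative H -> G}) : Prop :=
  forall x : H, exists h : G, phi1 x = phi2 x ^ h.

Definition globally_conjugate (G : groupType) (H : finGroupType)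
    (phi1 phi2 : {multiplicative H -> G}) : Prop :=
  exists h : G, forall x : H, phi1 x = phi2 x ^ h.

Definition acceptable (G : groupType) : Prop :=
  forall (H : finGroupType) (phi1 phi2 : {multiplicative H -> G}),
    element_conjugate phi1 phi2 -> globally_conjugate phi1 phi2.

End Acceptable.

(* K, viewed as an extension of F along iota, is an algebraic closure of F;
   that K is algebraically closed is part of its type. *)
Definition algebraic_closure_of (F : fieldType) (K : closedFieldType)
    (iota : {rmorphism F -> K}) : Prop :=
  forall x : K, algebraicOver iota x.

(* Main.v *)
Require Import Defs.
From mathcomp Require Import all_boot all_order all_fingroup all_algebra all_field.
From HB Require Import structures.

(** The counterexamples are unipotent: write [u(x)] for the upper unitriangular
    matrix with off-diagonal entry [x].  Over a closed field [K] every element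
    has a square root, and conjugating by [diag(c, 1/c)] scales [x] by a square,
    so all the [u(x)] with [x != 0] are conjugate in [SL_2(K)].  Hence for any
    finite additive group [V] in [K], the inclusion [x |-> u(x)] and its Frobenius
    twist [x |-> u(x ^ p)] are element-conjugate, both entries vanishing for the
    same [x].

    On the other hand a single [h] taking [u(y)] to [u(x)] with [x != 0] must be
    upper triangular, whence [y = a ^ 2 * x] with [a] its corner entry
    ([conjg_unipotent_eq]).  A global conjugation would thus make [x ^ p] a fixed
    multiple of [x] on [V]; if [1] is in [V], this multiple is [1] and [V] lies in
    the prime field.  It remains to take for [V] the plane spanned over the prime
    field by [1] and a root [t] of [X ^ p - X - 1], which the Frobenius map sends
    to [t + 1]. *)

Set Implicit Arguments.
Unset Strict Implicit.
Unset Printing Implicit Defensive.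

Import GRing.Theory.
Local Open Scope ring_scope.

(** [mulmx_block] at dimension [2] instead of [1 + 1]: these are convertible,
    but rewriting distinguishes them. *)
Lemma mulmx_block2 (R : pzSemiRingType) (a b c d a' b' c' d' : 'M[R]_1) :
  @mulmx R 2 2 2 (block_mx a b c d) (block_mx a' b' c' d') =
    block_mx (a *m a' + b *m c') (a *m b' + b *m d')
             (c *m a' + d *m c') (c *m b' + d *m d') :> 'M_(1 + 1).
Proof. exact: (@mulmx_block R 1 1 1 1 1 1). Qed.

Section Unipotent.
Variable R : comUnitRingType.
Implicit Types x y : R.

Fact unipotent_subproof x :
  \det (block_mx 1%:M x%:M 0 1%:M : 'M[R]_(1 + 1)) == 1.
Proof. by rewrite det_ublock !det1 mulr1. Qed.

Definition unipotent x : 'SL_2[R] := SLmx (unipotent_subproof x).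

Lemma unipotentD x y : unipotent (x + y) = (unipotent x * unipotent y)%g.
Proof.
apply: val_inj => /=; rewrite mulmx_block2.
by rewrite !mul1mx !mulmx1 !mul0mx !mulmx0 !addr0 add0r raddfD addrC.
Qed.

End Unipotent.

Section UnipotentConjugacy.
Variable F : fieldType.
Implicit Types c x y : F.

Fact SLdiag_subproof c : c != 0 ->
  \det (block_mx c%:M 0 0 c^-1%:M : 'M[F]_(1 + 1)) == 1.
Proof. by move=> nz_c; rewrite det_ublock !det_scalar1 divff. Qed.

(** The conjugating element is [diag(c, 1/c)]. *)
Lemma unipotent_conjg c x : c != 0 ->
  exists h : 'SL_2[F], unipotent x = (unipotent (c ^+ 2 * x) ^ h)%g.
Proof.
move=> nz_c; exists (SLmx (SLdiag_subproof nz_c)).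
apply: (mulgI (SLmx (SLdiag_subproof nz_c))); rewrite -conjgC.
apply: val_inj => /=; rewrite !mulmx_block2.
rewrite !mul1mx !mulmx1 !mul0mx !mulmx0 !addr0 !add0r -!scalar_mxM.
by rewrite mulrAC expr2 mulfK.
Qed.

(** Writing [a, b, c, d] for the entries of [h], comparing [h * u(x)] with
    [u(y) * h] yields [c * x = 0] and [a * x = y * d]; so [c = 0] and
    [d = 1 / a].  The factor [a ^ 2] depends on [h] alone. *)
Lemma conjg_unipotent_eq x y (h : 'SL_2[F]) :
  unipotent x = (unipotent y ^ h)%g -> x != 0 -> y = SLval h 0 0 ^+ 2 * x.
Proof.
move=> /(congr1 (mulg h)); rewrite -conjgC => /(congr1 (@SLval 2 F)) /= + nz_x.
have := SLval_det h; move: (SLval h : 'M_(1 + 1)) => A.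
rewrite -[\det A]/(@determinant F (1 + 1) A) -[A]submxK.
set a := ulsubmx A; set b := ursubmx A; set c := dlsubmx A.
set d := drsubmx A => detA; rewrite !mulmx_block2.
rewrite !mul1mx !mulmx1 !mul0mx !mulmx0 !addr0 !add0r.
case/(@eq_block_mx F 1 1 1 1) => _ eq_ur _ /eqP.
rewrite -subr_eq0 addrK mul_mx_scalar scaler_eq0 (negPf nz_x) => /eqP c0.
have ->: block_mx a b c d 0 0 = a 0 0.
  rewrite -(block_mxEul a b c d).
  by congr (block_mx _ _ _ _ _ _); apply: val_inj.
move: detA; rewrite c0 det_ublock !det_mx11 => ad1.
have: a 0 0 * x = y * d 0 0.
  move/matrixP/(_ 0 0): eq_ur; rewrite mul_mx_scalar mul_scalar_mx !mxE.
  by rewrite mulrC addrC => /addrI.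
by move=> axyd; rewrite expr2 -mulrA axyd mulrCA ad1 mulr1.
Qed.

End UnipotentConjugacy.

Section UnipotentRepresentation.
Variables (R : comUnitRingType) (V : finZmodType) (f : {additive V -> R}).

Definition unipotent_rep (v : V) : 'SL_2[R] := unipotent (f v).

Fact unipotent_rep_is_multiplicative : {morph unipotent_rep : v w / (v * w)%g}.
Proof.
by move=> v w; rewrite /unipotent_rep FinRing.zmodMgE raddfD unipotentD.
Qed.

HB.instance Definition _ :=
  isMultiplicative.Build V 'SL_2[R] unipotent_rep
    unipotent_rep_is_multiplicative.

End UnipotentRepresentation.

Lemma closed_sqrt (K : closedFieldType) (x : K) : exists c, c ^+ 2 = x.
Proof.
have [|c] := closed_rootP ('X^2 - x%:P) _; first by rewrite size_XnsubC.
by rewrite rootE !hornerE subr_eq0 => /eqP <-; exists c.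
Qed.

(** Where both entries are nonzero, a square root of their ratio provides the
    conjugating diagonal matrix. *)
Lemma unipotent_rep_element_conjugate (K : closedFieldType) (V : finZmodType)
    (f g : {additive V -> K}) :
    (forall v, (f v == 0) = (g v == 0)) ->
  element_conjugate (unipotent_rep f) (unipotent_rep g).
Proof.
move=> eq_ker v; rewrite /= /unipotent_rep.
have [f0 | nz_f] := eqVneq (f v) 0.
  by exists 1%g; rewrite conjg1 f0; move/eqP: f0; rewrite eq_ker => /eqP ->.
have [c Dc] := closed_sqrt (g v / f v).
have nz_c : c != 0 by rewrite -sqrf_eq0 Dc mulf_neq0 ?invr_eq0 -?eq_ker.
by have := unipotent_conjg (f v) nz_c; rewrite Dc mulfVK.
Qed.

Lemma unipotent_rep_globally_conjugate (F : fieldType) (V : finZmodType)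
    (f g : {additive V -> F}) :
    globally_conjugate (unipotent_rep f) (unipotent_rep g) ->
  exists c, forall v, f v != 0 -> g v = c * f v.
Proof.
case=> h conj_h; exists (SLval h 0 0 ^+ 2) => v.
exact: (conjg_unipotent_eq (conj_h v)).
Qed.

Section PrimePlane.
Variables (p : nat) (R : comNzRingType) (pcharRp : p \in [pchar R]) (t : R).

(** The coordinates scale [1] and [t] through the ['F_p]-algebra structure of
    [R], which only its alias [pPrimeCharType pcharRp] carries. *)
Definition prime_plane (v : 'rV['F_p]_2) : R :=
  v 0 0 *: (1 : pPrimeCharType pcharRp)
    + v 0 1 *: (t : pPrimeCharType pcharRp).

Fact prime_plane_is_zmod_morphism : zmod_morphism prime_plane.
Proof.
move=> v w; rewrite /prime_plane !mxE !(@scalerBl _ (pPrimeCharType pcharRp)).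
by rewrite addrACA opprD.
Qed.

HB.instance Definition _ :=
  GRing.isZmodMorphism.Build 'rV['F_p]_2 R prime_plane
    prime_plane_is_zmod_morphism.

End PrimePlane.

Lemma Artin_Schreier_root (p : nat) (K : closedFieldType) :
  (1 < p)%N -> exists t : K, t ^+ p = t + 1.
Proof.
move=> p_gt1; have [|t] := closed_rootP ('X^p - ('X + 1%:P) : {poly K}) _.
  rewrite size_polyDl size_polyXn ?size_polyN ?size_XaddC //.
  by case: p p_gt1 => [|[]].
by rewrite rootE !hornerE subr_eq0 => /eqP; exists t.
Qed.

Lemma SL2_not_acceptable (p : nat) (K : closedFieldType) :
  p \in [pchar K] -> ~ acceptable 'SL_2[K].
Proof.
move=> pcharKp accK; have p_pr := pcharf_prime pcharKp.
have [t Dt] := Artin_Schreier_root K (prime_gt1 p_pr).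
pose f : {additive 'rV['F_p]_2 -> K} := prime_plane pcharKp t.
pose g : {additive 'rV['F_p]_2 -> K} := (pFrobenius_aut pcharKp \o f).
have Dg v : g v = f v ^+ p by [].
have eq_ker v : (f v == 0) = (g v == 0).
  by rewrite Dg expf_eq0 prime_gt0.
have /accK := unipotent_rep_element_conjugate eq_ker.
case/unipotent_rep_globally_conjugate=> c Dc.
have f1 : f (delta_mx 0 0) = 1.
  by rewrite /= /prime_plane !mxE /= scale1r scale0r addr0.
have ft : f (delta_mx 0 1) = t.
  by rewrite /= /prime_plane !mxE /= scale1r scale0r add0r.
have c1 : c = 1.
  by have := Dc (delta_mx 0 0); rewrite Dg f1 expr1n mulr1 oner_eq0 => /(_ isT).
have nz_t : t != 0.
  apply: contra_eq_neq Dt => ->; rewrite add0r expr0n eq_sym.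
  by rewrite gtn_eqF ?prime_gt0 ?oner_eq0.
have := Dc (delta_mx 0 1); rewrite Dg ft c1 mul1r Dt => /(_ nz_t)/eqP.
by rewrite -subr_eq0 addrC addKr oner_eq0.
Qed.

Theorem corollary6p3 (p : nat) (hp : prime p)
    (q : nat) (hq : exists2 n : nat, (0 < n)%N & q = (p ^ n)%N)
    (Fq : finFieldType) (hFq : #|Fq| = q)
    (K : closedFieldType) (iota : {rmorphism Fq -> K})
    (hK : algebraic_closure_of iota) :
  ~ acceptable 'SL_2[K].
Proof.
case: hq => n _ Dq; apply: (@SL2_not_acceptable p).
by apply: (rmorph_pchar iota); apply: (@card_finPcharP _ p n); rewrite ?hFq.
Qed.
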